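(* Let $L$ and $L'$ be finite-dimensional left Leibniz algebras over a field $F$, and let $\phi : \mathcal{L}(L) \to \mathcal{L}(L')$ be a lattice isomorphism between their lattices of subalgebras. Suppose $\dim(L) \ge 3$. Then $\phi(\mathrm{Leib}(L)) = \mathrm{Leib}(L')$.
   Context: A left Leibniz algebra over a field $F$ is an $F$-vector space $L$ with a bilinear product satisfying $x(yz) = (xy)z + y(xz)$ for all $x,y,z \in L$. $\mathcal{L}(L)$ denotes the lattice of all subalgebras of $L$ (including $0$ and $L$), ordered by inclusion. The Leibniz kernel of $L$ is the linear span of squares $\mathrm{Leib}(L) = \langle x^2 \mid x \in L \rangle$, where $x^2 = xx$; it is a two-sided ideal of $L$ (hence a subalgebra), and $L/\mathrm{Leib}(L)$ is a Lie algebra. *)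

(* Defs.v *)
From HB Require Import structures.
From mathcomp Require Import all_boot all_order all_algebra.
From mathcomp Require Import boolp classical_sets.

Set Implicit Arguments.
Unset Strict Implicit.
Unset Printing Implicit Defensive.
Import Order.TTheory GRing.Theory.
Local Open Scope ring_scope.

(* Being a vectType, a leibnizType is finite-dimensional by construction. *)
HB.mixin Record isLeibniz (F : fieldType) L of Vector F L := {
  lbmul : {bilinear L -> L -> L};
  lbmul_leibniz : forall x y z : L,
    lbmul x (lbmul y z) = lbmul (lbmul x y) z + lbmul y (lbmul x z)
}.

#[short(type="leibnizType")]
HB.structure Definition Leibniz (F : fieldType) :=
  { L of isLeibniz F L & Vector F L }.

Notation "x ∘ y" := (lbmul x y) (at level 40, left associativity) : ring_scope.

Section LinearSpan.
Variables (F : fieldType) (V : vectType F).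
Implicit Types (A : set V) (U : {vspace V}) (s : seq V).

Lemma lspan_ex A : exists U, forall v,
  v \in U <-> exists2 s, (forall x, x \in s -> A x) & v \in <<s>>%VS.
Proof.
pose Q d := `[< exists2 s, (forall x, x \in s -> A x) & \dim <<s>>%VS = d >].
have Qex : exists d, Q d.
  by exists (\dim <<([::] : seq V)>>%VS); apply/asboolP; exists [::].
have Qub d : Q d -> (d <= \dim {:V})%N.
  by move=> /asboolP[s _ <-]; rewrite dimvS ?subvf.
case: (ex_maxnP Qex Qub) => d /asboolP[s sA sd] dmax.
exists <<s>>%VS => v; split=> [vs|[t tA vt]]; first by exists s.
have sub : (<<s>> <= <<s ++ t>>)%VS by rewrite span_cat addvSl.
have /eqP -> : (<<s>> == <<s ++ t>>)%VS.
  rewrite eqEdim sub sd dmax //; apply/asboolP; exists (s ++ t) => // x.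
  by rewrite mem_cat => /orP[/sA|/tA].
by apply: (subvP _ _ vt); rewrite span_cat addvSr.
Qed.

(* The linear span of an arbitrary, possibly infinite, set of vectors. *)
Definition lspan A : {vspace V} := projT1 (cid (lspan_ex A)).

Lemma lspanP A v :
  v \in lspan A <-> exists2 s, (forall x, x \in s -> A x) & v \in <<s>>%VS.
Proof. exact: (projT2 (cid (lspan_ex A))). Qed.

Lemma mem_lspan A v : A v -> v \in lspan A.
Proof.
move=> Av; apply/lspanP; exists [:: v]; last by rewrite memv_span ?mem_head.
by move=> x; rewrite inE => /eqP ->.
Qed.

Lemma lspan_sub A U : (lspan A <= U)%VS <-> (forall x, A x -> x \in U).
Proof.
split=> [/subvP AU x /mem_lspan /AU //|AU].
apply/subvP => v /lspanP[s sA]; apply: subvP.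
by apply/span_subvP => x /sA /AU.
Qed.

End LinearSpan.

Section Subalgebras.
Variables (F : fieldType) (L : leibnizType F).

Definition is_subalg (U : {vspace L}) : bool :=
  `[< {in U &, forall x y, x ∘ y \in U} >].

Record subalg := Subalg { subalg_vs :> {vspace L}; _ : is_subalg subalg_vs }.

HB.instance Definition _ := [isSub for subalg_vs].
HB.instance Definition _ := [Choice of subalg by <:].

Implicit Types U W : subalg.

Lemma subalg_closed U : {in (U : {vspace L}) &, forall x y, x ∘ y \in (U : {vspace L})}.
Proof. by case: U => U /= /asboolP. Qed.

Definition subalg_le U W : bool := (U <= W)%VS.

Lemma subalg_le_refl : reflexive subalg_le.
Proof. by move=> U; apply: subvv. Qed.

Lemma subalg_le_anti : antisymmetric subalg_le.
Proof.
by move=> U W UW; apply/val_inj/eqP; rewrite eqEsubv.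
Qed.

Lemma subalg_le_trans : transitive subalg_le.
Proof. by move=> U W X; apply: subv_trans. Qed.

Lemma capv_subalg U W : is_subalg (U :&: W)%VS.
Proof.
apply/asboolP => x y; rewrite !memv_cap => /andP[xU xW] /andP[yU yW].
by rewrite !subalg_closed.
Qed.

Definition subalg_meet U W : subalg := Subalg (capv_subalg U W).

(* The intersection of all subalgebras containing A; this intersection is
   already a subspace (mem_gen_vs), and lspan only turns it into a vspace. *)
Definition gen_vs (A : set L) : {vspace L} :=
  lspan [set v | forall U, (forall x, A x -> x \in (U : {vspace L})) ->
                   v \in (U : {vspace L})].

Lemma mem_gen_vs (A : set L) v : v \in gen_vs A <->
  forall U, (forall x, A x -> x \in (U : {vspace L})) -> v \in (U : {vspace L}).
Proof.
split=> [vA U AU|vA]; last exact: mem_lspan.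
by apply: (subvP _ _ vA); apply/lspan_sub => x; apply.
Qed.

Lemma gen_subalg_proof (A : set L) : is_subalg (gen_vs A).
Proof.
apply/asboolP => x y /mem_gen_vs xA /mem_gen_vs yA.
by apply/mem_gen_vs => U AU; apply: subalg_closed; [apply: xA|apply: yA].
Qed.

Definition subalg_gen (A : set L) : subalg := Subalg (gen_subalg_proof A).

Definition subalg_join U W : subalg :=
  subalg_gen [set x | x \in (U : {vspace L}) \/ x \in (W : {vspace L})].

Lemma subalg_meetP U W X :
  subalg_le U (subalg_meet W X) = subalg_le U W && subalg_le U X.
Proof. exact: subv_cap. Qed.

Lemma subalg_joinP U W X :
  subalg_le (subalg_join U W) X = subalg_le U X && subalg_le W X.
Proof.
apply/idP/andP => [/subvP UWX|[/subvP UX /subvP WX]].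
  by split; apply/subvP => x xU; apply: UWX; apply/mem_gen_vs => Y; apply;
    [left|right].
by apply/subvP => x /mem_gen_vs; apply=> y [/UX|/WX].
Qed.

End Subalgebras.

Fact subalg_display : Order.disp_t. Proof. exact: Order.Disp tt tt. Qed.

HB.instance Definition _ (F : fieldType) (L : leibnizType F) :=
  Order.Le_isPOrder.Build subalg_display (subalg L)
    (@subalg_le_refl F L) (@subalg_le_anti F L) (@subalg_le_trans F L).

HB.instance Definition _ (F : fieldType) (L : leibnizType F) :=
  Order.POrder_MeetJoin_isLattice.Build subalg_display (subalg L)
    (@subalg_meetP F L) (@subalg_joinP F L).

Section LeibnizKernel.
Variables (F : fieldType) (L : leibnizType F).

Definition leib_vs : {vspace L} := lspan [set v | exists x : L, v = x ∘ x].

Lemma leib_vs_mul0 (x y : L) : x \in leib_vs -> x ∘ y = 0.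
Proof.
move=> xL; have sq0 z : (z ∘ z) ∘ y = 0.
  by apply/(addIr (z ∘ (z ∘ y))); rewrite add0r -lbmul_leibniz.
have /lspanP[s sq xs] := xL.
rewrite (coord_span (X := in_tuple s) xs) linear_sumlz.
rewrite big1 // => i _; rewrite linearZl_LR.
by have [|z ->] := sq (in_tuple s)`_i; rewrite ?mem_nth //= sq0 scaler0.
Qed.

Lemma leib_subalg_proof : is_subalg leib_vs.
Proof. by apply/asboolP => x y xL _; rewrite leib_vs_mul0 ?mem0v. Qed.

Definition Leib : subalg L := Subalg leib_subalg_proof.

End LeibnizKernel.

Arguments Leib {F} L.

(* Main.v *)
Require Import Defs.
From mathcomp Require Import all_boot all_order all_algebra zify.
From mathcomp Require Import boolp classical_sets.

(** The Leibniz kernel is spanned by the squares, so it is enough to see that the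
    lattice isomorphism [f], and likewise its inverse, sends each line spanned
    by a nonzero square [x ∘ x] into the kernel.  The atoms of the subalgebra
    lattice are the lines spanned by vectors of square zero, and [f] is followed
    on such vectors.

    First work inside the cyclic subalgebra [C = gen1 x].  Its kernel part
    [A = C ∩ Leib L] has codimension one and is the smallest subspace of [Leib L]
    that contains [x ∘ x] and is stable under [x].  Let [A'] be the kernel part
    of [f C].

    If [A' <= f A], let [y'] be a vector of [f C] outside [f A].  The subalgebra
    [F y' + A'] meets [f A] in [A'], so its preimage meets [A] in the preimage
    [As] of [A'] and contains some [x + v] with [v] in [A].  Hence [As] is
    [x]-stable and contains [x ∘ x + x ∘ v].  As multiplication by [x] is
    bijective on [A / As], the class of [v] modulo [As], and with it the whole
    preimage, does not depend on [y'].  Replacing [y'] by [y' + w'] with [w'] in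
    [f A] therefore gives [w'] in [A'], that is [f A <= A'] ([cyc_image_sub]).

    If [A' <= f A] fails, [f C] has an atom in the kernel but outside [f A], which
    comes from an [x + v] of square zero.  This forces [C] to be two-dimensional,
    with exactly two atoms, and [f] to exchange the roles of the two atoms
    ([kernel_outside_swapped]).  That does occur when [L = C], and the last
    step is to exclude it in dimension three or more ([swapped_dim]).

    So let [a] in [Leib L] and [b] with [b ∘ a = a] correspond to [b'] and [a'],
    where [a'] is in [Leib L'] and [b' ∘ a' = a'].  The tool is a lattice property,
    [thick], that holds for planes with zero product and forces every
    square in the subalgebra to be zero.  It shows that no [c] can generate a thick
    subalgebra both with [a] and with [b] ([swapped_thick]), and from this that
    [Leib L] is the line of [a], and [Leib L'] the line of [a']
    ([swapped_Leib_line]).  Then [L] acts on the line [Leib L] by scalars, so if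
    its dimension is at least three some [k] outside that line kills [a].  If
    [k ∘ k = 0], then [a] and [k] span a thick plane, which is excluded because
    [L'] too acts on its kernel by scalars; if not, [a] spans the only atom of
    [F k + F a], whereas a subalgebra whose only atom is spanned by [b'] cannot
    exist: a vector outside the line of [b'] would have a nonzero square, and
    that square is a multiple of [a']. *)

Import Order.TTheory GRing.Theory.
Local Open Scope ring_scope.
Set Implicit Arguments.
Unset Strict Implicit.
Unset Printing Implicit Defensive.

Local Notation "x ∈ U" := (x \in subalg_vs U) (at level 70).
Local Notation "x ∉ U" := (x \notin subalg_vs U) (at level 70).
Local Notation mulE := (linearDl, linearDr, linearBl, linearBr, linearNl,
  linearNr, linearZl_LR, linearZr_LR, linear0l, linear0r) (only parsing).

(** * Subalgebras, the Leibniz kernel and thick subalgebras *)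

Section Algebra.
Variables (F : fieldType) (L : leibnizType F).
Implicit Types (u v w x y z : L) (U V W : subalg L) (X : {vspace L}).

Lemma memv_line2 v x y :
  reflect (exists s t, v = s *: x + t *: y) (v \in <[x]> + <[y]>)%VS.
Proof.
apply: (iffP memv_addP) => [[_ /vlineP[s ->] [_ /vlineP[t ->] ->]]|[s [t ->]]].
  by exists s, t.
by exists (s *: x); rewrite ?memvZ ?memv_line //; exists (t *: y);
  rewrite ?memvZ ?memv_line.
Qed.

Lemma memv_line_add v x X :
  reflect (exists s w, w \in X /\ v = s *: x + w) (v \in <[x]> + X)%VS.
Proof.
apply: (iffP memv_addP) => [[_ /vlineP[s ->] [w wX ->]]|[s [w [wX ->]]]].
  by exists s, w.
by exists (s *: x); rewrite ?memvZ ?memv_line //; exists w.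
Qed.

Lemma vlineP_sym x y : y != 0 -> y \in <[x]>%VS -> x \in <[y]>%VS.
Proof.
move=> y0 /vlineP[k yE]; apply/vlineP; exists k^-1.
rewrite yE scalerA mulVf ?scale1r //.
by apply: contraNneq y0 => k0; rewrite yE k0 scale0r.
Qed.

Lemma mem_Leib_sq x : x ∘ x ∈ Leib L.
Proof. by apply: mem_lspan; exists x. Qed.

Lemma Leib_mul0 x y : x ∈ Leib L -> x ∘ y = 0.
Proof. exact: leib_vs_mul0. Qed.

Lemma lbmul_sqD x y : (x + y) ∘ (x + y) = x ∘ x + (x ∘ y + y ∘ x) + y ∘ y.
Proof. by rewrite !mulE !addrA. Qed.

Lemma Leib_anticomm x y : x ∘ y + y ∘ x ∈ Leib L.
Proof.
have -> : x ∘ y + y ∘ x = (x + y) ∘ (x + y) - x ∘ x - y ∘ y.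
  by rewrite lbmul_sqD addrAC addrK [X in X - _]addrC addrK.
by rewrite !memvB ?mem_Leib_sq.
Qed.

(** The Leibniz identity gives [x (z z) = (x z) z + z (x z)], which is a
    polarized square. *)
Lemma Leib_ideal x y : y ∈ Leib L -> x ∘ y ∈ Leib L.
Proof.
have sub : (leib_vs L <= linfun (lbmul x) @^-1: leib_vs L)%VS.
  apply/lspan_sub => _ [z ->]; rewrite -memv_preim lfunE /= lbmul_leibniz.
  exact: Leib_anticomm.
by move=> /(subvP sub); rewrite -memv_preim lfunE.
Qed.

Lemma is_subalg_line x : x ∘ x = 0 -> is_subalg <[x]>%VS.
Proof.
move=> xx; apply/asboolP => ? ? /vlineP[s ->] /vlineP[t ->].
by rewrite !mulE xx !scaler0 mem0v.
Qed.

(** The kernel multiplies everything to zero from the left, so only products with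
    [x] on the left have to be controlled. *)
Lemma is_subalg_line_add x X : (X <= leib_vs L)%VS -> x ∘ x \in X ->
  (forall w, w \in X -> x ∘ w \in X) -> is_subalg (<[x]> + X)%VS.
Proof.
move=> XL xxX xX; apply/asboolP => ? ?.
move=> /memv_line_add[s [w [wX ->]]] /memv_line_add[t [w' [w'X ->]]].
apply: (subvP (addvSr _ _)).
rewrite [_ ∘ _]linearDl (@Leib_mul0 w) ?(subvP XL) // addr0.
by rewrite !mulE memvD // !memvZ // xX.
Qed.

Lemma is_subalg_line2 x y : x ∘ x = 0 -> y ∘ y = 0 -> x ∘ y = 0 -> y ∘ x = 0 ->
  is_subalg (<[x]> + <[y]>)%VS.
Proof.
move=> xx yy xy yx; apply/asboolP => ? ? /memv_line2[s [t ->]] /memv_line2[p [q ->]].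
by rewrite !mulE xx yy xy yx !scaler0 !addr0 mem0v.
Qed.

Lemma subalg_mul U x y : x ∈ U -> y ∈ U -> x ∘ y ∈ U.
Proof. exact: Defs.subalg_closed. Qed.

Definition gen1 x : subalg L := subalg_gen [set y | y = x].
Definition gen2 x y : subalg L := subalg_gen [set z | z = x \/ z = y].

Lemma gen1_le x U : subalg_le (gen1 x) U = (x ∈ U).
Proof.
apply/idP/idP => [/subvP|xU]; first by apply; apply/mem_gen_vs => V; apply.
by apply/subvP => v /mem_gen_vs; apply => _ ->.
Qed.

Lemma gen2_le x y U : subalg_le (gen2 x y) U = (x ∈ U) && (y ∈ U).
Proof.
apply/idP/andP => [/subvP le|[xU yU]].
  by split; apply: le; apply/mem_gen_vs => V; apply; [left|right].
by apply/subvP => v /mem_gen_vs; apply => _ [] ->.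
Qed.

Lemma gen2C x y : gen2 x y = gen2 y x.
Proof.
by apply: subalg_le_anti; apply/andP; split; rewrite gen2_le andbC -gen2_le
  subalg_le_refl.
Qed.

Lemma mem_gen1 x : x ∈ gen1 x.
Proof. by rewrite -gen1_le subalg_le_refl. Qed.

Lemma mem_gen2l x y : x ∈ gen2 x y.
Proof. by have := subalg_le_refl (gen2 x y); rewrite gen2_le => /andP[]. Qed.

Lemma mem_gen2r x y : y ∈ gen2 x y.
Proof. by rewrite gen2C mem_gen2l. Qed.
Hint Resolve mem_gen1 mem_gen2l mem_gen2r : core.

Lemma gen1Z x k : k != 0 -> gen1 (k *: x) = gen1 x.
Proof.
move=> k0; apply: subalg_le_anti; rewrite !gen1_le memvZ //=.
by have := memvZ k^-1 (mem_gen1 (k *: x)); rewrite scalerK.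
Qed.

Lemma gen1_sub x X : is_subalg X -> x \in X -> (gen1 x <= X)%VS.
Proof.
by move=> sX xX; rewrite -[(_ <= X)%VS]/(subalg_le _ (Subalg sX)) gen1_le.
Qed.

Lemma gen2_sub x y X : is_subalg X -> x \in X -> y \in X -> (gen2 x y <= X)%VS.
Proof.
move=> sX xX yX; rewrite -[(_ <= X)%VS]/(subalg_le _ (Subalg sX)) gen2_le /=.
by rewrite xX.
Qed.

Lemma gen1_line x : x ∘ x = 0 -> gen1 x = <[x]>%VS :> {vspace L}.
Proof.
move=> xx; apply/eqP; rewrite eqEsubv gen1_sub ?memv_line ?is_subalg_line //=.
by rewrite -memvE mem_gen1.
Qed.

Definition bot : subalg L := Subalg (is_subalg_line (linear0l _ 0)).

Lemma bot_le U : subalg_le bot U.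
Proof. by rewrite /subalg_le /= -memvE mem0v. Qed.

Lemma bot_vs : bot = 0%VS :> {vspace L}.
Proof. by apply/eqP; rewrite /= -subv0 -memvE mem0v. Qed.

Lemma neq_botP U : U <> bot <-> exists2 x, x ∈ U & x != 0.
Proof.
split=> [Ub|[x xU x0] Ub]; last by move: xU; rewrite Ub bot_vs memv0 (negPf x0).
have U0 : subalg_vs U != 0%VS.
  by apply/eqP => U0; apply: Ub; apply: val_inj; rewrite /= U0 -bot_vs.
by exists (vpick U); rewrite ?memv_pick ?vpick0.
Qed.

Lemma gen1_neq_bot x : x != 0 -> gen1 x <> bot.
Proof. by move=> x0; apply/neq_botP; exists x. Qed.

(** A nonzero subalgebra contains a line: if [x] does not square to zero, then
    its square does. *)
Lemma ex_sq0 U x : x ∈ U -> x != 0 ->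
  exists y, [/\ y ∈ U, y != 0 & y ∘ y = 0].
Proof.
move=> xU x0; have [xx|xx] := eqVneq (x ∘ x) 0; first by exists x.
by exists (x ∘ x); split=> //; [exact: subalg_mul|exact/Leib_mul0/mem_Leib_sq].
Qed.

(** Length at most two and at least three atoms: the part of the lattice
    structure of a plane with zero product that is used.  A two-dimensional
    algebra with a nonzero square has at most two atoms. *)
Definition thick U :=
  (forall V W, subalg_le V W -> subalg_le W U -> [\/ V = bot, V = W | W = U]) /\
  (forall V1 V2, exists V,
     [/\ subalg_le V U, V <> bot, V <> U, V <> V1 & V <> V2]).

Lemma sq_notin_line u : u ∘ u != 0 -> u \notin <[u ∘ u]>%VS.
Proof.
apply: contra => /vlineP[k uE]; rewrite {1}uE linearZl_LR.
by rewrite (Leib_mul0 _ (mem_Leib_sq u)) scaler0.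
Qed.

Lemma sq_notin_Leib u : u ∘ u != 0 -> u ∉ Leib L.
Proof. by apply: contra => uL; rewrite Leib_mul0. Qed.

(** If [u ∘ u] were nonzero, then [u] would generate [U], so that [U] would be
    spanned by [u] and [u ∘ u], with at most two lines of square zero. *)
Lemma thick_sq0 U u : thick U -> u ∈ U -> u ∘ u = 0.
Proof.
move=> [len atoms] uU; apply/eqP/negPn/negP => u20.
set n := u ∘ u; have nL : n ∈ Leib L := mem_Leib_sq u.
have nn : n ∘ n = 0 by rewrite Leib_mul0.
have nU : n ∈ U by apply: subalg_mul.
have uNn : u \notin <[n]>%VS by exact: sq_notin_line.
pose N := subalg_meet U (Leib L).
have NE : gen1 n = N.
  have [] := len (gen1 n) N; rewrite ?gen1_le ?subalg_meetP //.
  - by rewrite /= memv_cap nU.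
  - exact: capvSl.
  - by move/(gen1_neq_bot u20).
  - move=> NU; move: uU; rewrite -NU /= memv_cap (negPf (sq_notin_Leib u20)).
    by rewrite andbF.
have [k unE] : exists k, u ∘ n = k *: n.
  apply/vlineP; rewrite -gen1_line // NE /= memv_cap Leib_ideal //.
  by rewrite subalg_mul.
have UE : (U <= <[u]> + <[n]>)%VS.
  have [] := len (gen1 n) (gen1 u); rewrite ?gen1_le //.
  - exact: subalg_mul.
  - by move/(gen1_neq_bot u20).
  - by move=> E; move: (mem_gen1 u); rewrite -E gen1_line // (negPf uNn).
  move=> <-; apply: gen1_sub; last by rewrite (subvP (addvSl _ _)) ?memv_line.
  apply: is_subalg_line_add; rewrite ?memv_line -?memvE //.
  by move=> _ /vlineP[t ->]; rewrite linearZr_LR unE !memvZ ?memv_line.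
have [V [VU V0 VneU Vn Vq]] := atoms (gen1 n) (gen1 (n - k *: u)).
have /neq_botP[v0 v0V v00] := V0; have [v [vV v_0 vv]] := ex_sq0 v0V v00.
have VE : gen1 v = V.
  case: (len (gen1 v) V) => //; rewrite ?gen1_le //.
  by move/(gen1_neq_bot v_0).
have /memv_line2[s [t vE]] := subvP UE _ (subvP VU _ vV).
have vn : (s * (s + t * k)) *: n = 0.
  rewrite -vv {1}vE linearDl linearZl_LR [(t *: n) ∘ v]linearZl_LR (@Leib_mul0 n) //.
  by rewrite vE linearDr !linearZr_LR unE scalerA -scalerDl scalerA scaler0 addr0.
have := v_0; rewrite vE; have /orP[/eqP s0|] : (s == 0) || (s == - (t * k)).
- by move/eqP: vn; rewrite scaler_eq0 (negPf u20) orbF mulf_eq0 addr_eq0.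
- rewrite s0 scale0r add0r scaler_eq0 negb_or => /andP[t0 _]; apply: Vn.
  by rewrite -VE vE s0 scale0r add0r gen1Z.
move/eqP=> sE; have {vE}vE : v = t *: (n - k *: u).
  by rewrite vE sE scalerBr scalerA scaleNr addrC.
move=> _; move: v_0; rewrite {1}vE scaler_eq0 negb_or => /andP[t0 _].
by apply: Vq; rewrite -VE vE gen1Z.
Qed.

Lemma thick_anticomm U x y : thick U -> x ∈ U -> y ∈ U -> x ∘ y = - (y ∘ x).
Proof.
move=> tU xU yU; have := thick_sq0 tU (memvD xU yU).
rewrite lbmul_sqD !(thick_sq0 tU) // add0r addr0.
by move/eqP; rewrite addr_eq0 => /eqP.
Qed.

(** Length two leaves no room between the line of [x] and [U]. *)
Lemma thick_gen2 U x y : thick U -> x ∈ U -> y ∈ U -> x != 0 ->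
  y \notin <[x]>%VS -> gen2 x y = U.
Proof.
move=> tU xU yU x0 yx; case: (tU) => len _.
have [] := len (gen1 x) (gen2 x y); rewrite ?gen1_le ?gen2_le ?xU ?yU //.
- by move/(gen1_neq_bot x0).
move=> E; move: (mem_gen2r x y); rewrite -E gen1_line ?(negPf yx) //.
exact: (thick_sq0 tU).
Qed.

Lemma thick_notin_line x y : thick (gen2 x y) -> y \notin <[x]>%VS.
Proof.
move=> tU; have [len atoms] := tU; apply/negP => yx.
have xx := thick_sq0 tU (mem_gen2l x y).
have [V [VU V0 VneU _ _]] := atoms bot bot.
have /neq_botP[v vV v0] := V0; apply: VneU; apply: subalg_le_anti; rewrite VU.
have xV : x ∈ V.
  have := subvP (gen2_sub (is_subalg_line xx) (memv_line x) yx) _ (subvP VU _ vV).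
  move=> /(vlineP_sym v0) /vlineP[k ->]; exact: memvZ.
rewrite gen2_le xV /=; case/vlineP: yx => k ->; exact: memvZ.
Qed.

(** The three lines of [x], [y] and [x + y] exist over every field, which is why
    [thick] asks for three atoms. *)
Lemma thick_gen2_comm x y : x ∘ x = 0 -> y ∘ y = 0 -> x ∘ y = 0 -> y ∘ x = 0 ->
  x != 0 -> y \notin <[x]>%VS -> thick (gen2 x y).
Proof.
move=> xx yy xy yx x0 yNx.
have sub : (gen2 x y <= <[x]> + <[y]>)%VS.
  apply: gen2_sub; first exact: is_subalg_line2.
    by rewrite (subvP (addvSl _ _)) ?memv_line.
  by rewrite (subvP (addvSr _ _)) ?memv_line.
have dimU : (\dim (gen2 x y) <= 2)%N.
  apply: leq_trans (dimvS sub) _; apply: leq_trans (dimv_add_leqif _ _) _.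
  by rewrite !dim_vline; case: (x != 0); case: (y != 0).
have lt V W : subalg_le V W -> V <> W -> (\dim V < \dim W)%N.
  move=> VW VneW; rewrite ltnNge; apply: contra_notN VneW => le.
  by apply: val_inj; apply/eqP; rewrite /= eqEdim le andbT.
have y0 : y != 0 by apply: contraNneq yNx => ->; rewrite mem0v.
split=> [V W VW WU|V1 V2].
  have [|V0] := pselect (V = bot); first by constructor 1.
  have [|VneW] := pselect (V = W); first by constructor 2.
  have [|WneU] := pselect (W = gen2 x y); first by constructor 3.
  have := leq_trans (lt _ _ WU WneU) dimU; have := lt _ _ VW VneW.
  have := lt _ _ (bot_le V) (nesym V0); rewrite bot_vs dimv0.
  by case: (\dim V) (\dim W) => [|?] // [|[|?]].
have xNy : x \notin <[y]>%VS by apply: contra yNx; apply: vlineP_sym.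
have zz : (x + y) ∘ (x + y) = 0 by rewrite lbmul_sqD xx yy xy yx !addr0.
have zNx : x + y \notin <[x]>%VS.
  by apply: contra yNx => /memvB/(_ (memv_line x)); rewrite addrC addKr.
have zNy : x + y \notin <[y]>%VS.
  by apply: contra xNy => /memvB/(_ (memv_line y)); rewrite addrK.
have xyU : x + y ∈ gen2 x y by rewrite memvD.
have ok v : v ∈ gen2 x y -> v != 0 -> v ∘ v = 0 -> gen1 v <> V1 -> gen1 v <> V2 ->
    exists V,
      [/\ subalg_le V (gen2 x y), V <> bot, V <> gen2 x y, V <> V1 & V <> V2].
  move=> vU v0 vv v1 v2; exists (gen1 v); split; rewrite ?gen1_le //.
    exact: gen1_neq_bot.
  move=> E; move: (mem_gen2l x y) (mem_gen2r x y); rewrite -E gen1_line //.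
  move=> /(vlineP_sym x0) vx yv; case/negP: yNx.
  by apply: subvP yv; rewrite -memvE.
have d1 : gen1 x <> gen1 y.
  by move=> E; move: (mem_gen1 x); rewrite E gen1_line // (negPf xNy).
have d2 : gen1 x <> gen1 (x + y).
  by move=> E; move: (mem_gen1 (x + y)); rewrite -E gen1_line // (negPf zNx).
have d3 : gen1 y <> gen1 (x + y).
  by move=> E; move: (mem_gen1 (x + y)); rewrite -E gen1_line // (negPf zNy).
have z0 : x + y != 0 by apply: contraNneq zNx => ->; rewrite mem0v.
have [[? ?]|nx] := pselect (gen1 x <> V1 /\ gen1 x <> V2); first exact: (ok x).
have [[? ?]|ny] := pselect (gen1 y <> V1 /\ gen1 y <> V2); first exact: (ok y).
apply: (ok (x + y)) => // zE; apply: nx; split=> xE; do ?[congruence];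
  apply: ny; split=> yE; congruence.
Qed.
End Algebra.

#[local] Hint Extern 0 (is_true (in_mem _ _)) =>
  solve [exact: mem_gen1 | exact: mem_gen2l | exact: mem_gen2r] : core.

(** * Isomorphisms of subalgebra lattices *)

Definition lat_iso (F : fieldType) (L L' : leibnizType F)
    (f : subalg L -> subalg L') (g : subalg L' -> subalg L) :=
  [/\ cancel f g, cancel g f & forall U V, subalg_le (f U) (f V) = subalg_le U V].

Lemma lat_iso_sym (F : fieldType) (L L' : leibnizType F)
    (f : subalg L -> subalg L') (g : subalg L' -> subalg L) :
  lat_iso f g -> lat_iso g f.
Proof. by case=> fK gK fle; split=> // U V; rewrite -fle !gK. Qed.

(** [x] and [x'] span corresponding atoms: the minimal nonzero subalgebras are
    exactly the lines spanned by vectors of square zero. *)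
Definition corr (F : fieldType) (L L' : leibnizType F)
    (f : subalg L -> subalg L') (x : L) (x' : L') :=
  [/\ x != 0, x ∘ x = 0, x' != 0, x' ∘ x' = 0 & f (gen1 x) = gen1 x'].

Section LatticeIso.
Variables (F : fieldType) (L L' : leibnizType F).
Variables (f : subalg L -> subalg L') (g : subalg L' -> subalg L).
Hypothesis iso : lat_iso f g.
Implicit Types (U V : subalg L).

Let fK : cancel f g. Proof. by case: iso. Qed.
Let gK : cancel g f. Proof. by case: iso. Qed.

Lemma iso_le U V : subalg_le (f U) (f V) = subalg_le U V.
Proof. by case: iso. Qed.

Lemma iso_inj U V : f U = f V -> U = V.
Proof. by move/(can_inj fK). Qed.

Lemma iso_bot : f (bot L) = bot L'.
Proof.
apply: subalg_le_anti; rewrite bot_le andbT -[X in subalg_le _ X]gK iso_le.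
exact: bot_le.
Qed.

Lemma iso_eq_bot U : f U = bot L' -> U = bot L.
Proof. by rewrite -iso_bot => /iso_inj. Qed.

Lemma iso_gen2 (x y : L) (x' y' : L') :
  f (gen1 x) = gen1 x' -> f (gen1 y) = gen1 y' -> f (gen2 x y) = gen2 x' y'.
Proof.
move=> xE yE.
have key (U : subalg L') : subalg_le (f (gen2 x y)) U = subalg_le (gen2 x' y') U.
  by rewrite -(gK U) iso_le !gen2_le -!gen1_le -xE -yE !iso_le.
by apply: subalg_le_anti; rewrite key subalg_le_refl -key subalg_le_refl.
Qed.

Lemma corr_sym x x' : corr f x x' -> corr g x' x.
Proof. by case=> *; split=> //; apply: (can_inj fK); rewrite gK. Qed.

Lemma corr_mem x x' U : corr f x x' -> (x' ∈ f U) = (x ∈ U).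
Proof. by case=> _ _ _ _ E; rewrite -!gen1_le -E iso_le. Qed.

Lemma corr_ex (x : L) : x != 0 -> x ∘ x = 0 -> exists x', corr f x x'.
Proof.
move=> x0 xx; have /neq_botP[y' yU y0] : f (gen1 x) <> bot L'.
  by move/iso_eq_bot; exact: gen1_neq_bot.
have {y' yU y0}[x' [xU x'0 xx']] := ex_sq0 yU y0; exists x'; split=> //.
apply: subalg_le_anti; rewrite gen1_le xU andbT -[gen1 x']gK iso_le.
have := xU; rewrite -gen1_le -[gen1 x']gK iso_le => le.
have /neq_botP[z zU z0] : g (gen1 x') <> bot L.
  by move=> E; apply: (gen1_neq_bot x'0); rewrite -(gK (gen1 x')) E iso_bot.
have := subvP le _ zU; rewrite gen1_line // => /(vlineP_sym z0) /vlineP[k ->].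
by rewrite gen1_le fK; exact: memvZ.
Qed.

Lemma corr_line x y x' y' : corr f x x' -> corr f y y' ->
  (x' \in <[y']>%VS) = (x \in <[y]>%VS).
Proof.
move=> xx' [_ yy _ yy' E].
by rewrite -(gen1_line yy) -(gen1_line yy') -E (corr_mem _ xx').
Qed.

Lemma corr_gen2 x y x' y' : corr f x x' -> corr f y y' ->
  f (gen2 x y) = gen2 x' y'.
Proof. by move=> [_ _ _ _ xE] [_ _ _ _ yE]; apply: iso_gen2. Qed.

Lemma corr_mem_gen2 x y z x' y' z' : corr f x x' -> corr f y y' -> corr f z z' ->
  (z' ∈ gen2 x' y') = (z ∈ gen2 x y).
Proof. by move=> xx' yy' zz'; rewrite -(corr_gen2 xx' yy') (corr_mem _ zz'). Qed.

Lemma iso_thick U : thick U -> thick (f U).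
Proof.
move=> [len atoms]; split=> [V W VW WU|V1 V2].
  have gVW : subalg_le (g V) (g W) by rewrite -iso_le !gK.
  have gWU : subalg_le (g W) U by rewrite -iso_le gK.
  have [E|E|E] := len _ _ gVW gWU.
  - by constructor 1; rewrite -(gK V) E iso_bot.
  - by constructor 2; rewrite -(gK V) E gK.
  - by constructor 3; rewrite -E gK.
have [V [VU V0 VneU VV1 VV2]] := atoms (g V1) (g V2); exists (f V); split.
- by rewrite iso_le.
- by move/iso_eq_bot.
- by move/iso_inj.
- by move=> E; apply: VV1; rewrite -E fK.
- by move=> E; apply: VV2; rewrite -E fK.
Qed.

Lemma corr_thick x y x' y' : corr f x x' -> corr f y y' ->
  thick (gen2 x y) -> thick (gen2 x' y').
Proof. by move=> xx' yy' /iso_thick; rewrite (corr_gen2 xx' yy'). Qed.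

Lemma corrZ x x' k : k != 0 -> corr f x x' -> corr f (k *: x) x'.
Proof.
move=> k0 [x0 xx x'0 xx' E]; split=> //; last by rewrite gen1Z.
  by rewrite scaler_eq0 negb_or k0.
by rewrite !mulE xx !scaler0.
Qed.

End LatticeIso.

(** * The exchanged pair *)

Lemma stable_inj_surj (F : fieldType) (V : vectType F) (T : 'End(V))
    (Z : {vspace V}) :
  (forall z, z \in Z -> T z \in Z) -> (forall z, z \in Z -> T z = 0 -> z = 0) ->
  forall z, z \in Z -> exists2 y, y \in Z & z = T y.
Proof.
move=> TZ Tinj z zZ.
have sub : (T @: Z <= Z)%VS by apply/subvP => _ /memv_imgP[y yZ ->]; apply: TZ.
have /eqP TE : (T @: Z == Z)%VS.
  rewrite eqEdim sub limg_dim_eq ?leqnn //; apply/eqP; rewrite -subv0.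
  apply/subvP => y; rewrite memv_cap memv_ker memv0 => /andP[yZ /eqP Ty].
  by rewrite (Tinj _ yZ Ty).
by move: zZ; rewrite -{1}TE => /memv_imgP.
Qed.

Section Pair.
Variables (F : fieldType) (L : leibnizType F).
Implicit Types (a b d x : L) (U : subalg L).

Lemma eigen_notin_Leib a b : a != 0 -> b ∘ a = a -> b ∉ Leib L.
Proof. by move=> a0 ba; apply: contraNN a0 => bL; rewrite -ba Leib_mul0. Qed.

Lemma thick_eigen U a b : a != 0 -> a ∈ Leib L -> b ∘ a = a -> thick U ->
  a ∈ U -> b ∈ U -> False.
Proof.
move=> a0 aL ba tU aU bU; move/eqP: a0; apply.
by rewrite -ba (thick_anticomm tU) // Leib_mul0 ?oppr0.
Qed.

Lemma gen2_Leib_sub a d : a ∈ Leib L -> d ∘ d = 0 ->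
  (gen2 a d <= <[d]> + Leib L)%VS.
Proof.
move=> aL dd; apply: gen2_sub; rewrite ?(subvP (addvSr _ _) a) //.
  by apply: is_subalg_line_add => [//||w wL]; [rewrite dd mem0v|apply: Leib_ideal].
by rewrite (subvP (addvSl _ _)) ?memv_line.
Qed.

Lemma gen2_eigen_sub a d : a ∈ Leib L -> d ∘ d = 0 -> d ∘ a \in <[a]>%VS ->
  (gen2 a d <= <[d]> + <[a]>)%VS.
Proof.
move=> aL dd da; apply: gen2_sub.
- apply: is_subalg_line_add => [|| _ /vlineP[k ->]]; rewrite -?memvE ?dd ?mem0v //.
  by rewrite linearZr_LR memvZ.
- by rewrite (subvP (addvSr _ _)) ?memv_line.
by rewrite (subvP (addvSl _ _)) ?memv_line.
Qed.

End Pair.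

(** The exceptional situation in two-dimensional algebras: [F a + F b] and
    [F a' + F b'] have two atoms each, and [f] sends the atom in the kernel to
    the one outside it. *)
Record swapped (F : fieldType) (L L' : leibnizType F)
    (f : subalg L -> subalg L') (a b : L) (a' b' : L') : Prop := Swapped {
  swapped_Leib : a ∈ Leib L;
  swapped_eigen : b ∘ a = a;
  swapped_Leib' : a' ∈ Leib L';
  swapped_eigen' : b' ∘ a' = a';
  swapped_corr : corr f a b';
  swapped_corr' : corr f b a' }.

Lemma swapped_sym (F : fieldType) (L L' : leibnizType F)
    (f : subalg L -> subalg L') (g : subalg L' -> subalg L) a b a' b' :
  lat_iso f g -> swapped f a b a' b' -> swapped g a' b' a b.
Proof. by move=> iso [] *; split=> //; apply: (corr_sym iso). Qed.

Section Swapped.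
Variables (F : fieldType) (L L' : leibnizType F).
Variables (f : subalg L -> subalg L') (g : subalg L' -> subalg L).
Variables (a b : L) (a' b' : L').
Hypothesis iso : lat_iso f g.
Hypothesis sw : swapped f a b a' b'.

Let aL : a ∈ Leib L. Proof. by case: sw. Qed.
Let a'L : a' ∈ Leib L'. Proof. by case: sw. Qed.
Let ba : b ∘ a = a. Proof. by case: sw. Qed.
Let b'a' : b' ∘ a' = a'. Proof. by case: sw. Qed.
Let ab' : corr f a b'. Proof. by case: sw. Qed.
Let ba' : corr f b a'. Proof. by case: sw. Qed.
Let a0 : a != 0. Proof. by case: ab'. Qed.
Let b0 : b != 0. Proof. by case: ba'. Qed.
Let a'0 : a' != 0. Proof. by case: ba'. Qed.
Let b'0 : b' != 0. Proof. by case: ab'. Qed.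
Let isog : lat_iso g f := lat_iso_sym iso.

(** Otherwise [b'] and [c'] anticommute, and [a'] commutes with [c'] with zero
    product.  For [d' = a' + c'] then [b' ∘ d' + d' ∘ b' = a'], so that
    [b] lies in the subalgebra generated by [a] and [d].  As [d] acts on [a] by a
    scalar, that subalgebra is [F d + F a], which puts [a] into the thick
    subalgebra generated by [b] and [c]. *)
Lemma swapped_thick c c' : corr f c c' -> thick (gen2 a c) -> thick (gen2 b c) ->
  False.
Proof.
move=> cc' tac tbc; have tD := corr_thick iso ab' cc' tac.
have tE := corr_thick iso ba' cc' tbc.
have c'b' : c' ∘ b' = - (b' ∘ c') by exact: (thick_anticomm tD).
have a'c' : a' ∘ c' = 0 by rewrite Leib_mul0.
have c'a' : c' ∘ a' = 0 by rewrite (thick_anticomm tE) // a'c' oppr0.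
pose d' := a' + c'; have d'E : d' ∈ gen2 a' c' by apply: memvD.
have d'sq := thick_sq0 tE d'E.
have d'Na : d' \notin <[a']>%VS.
  apply: contra (thick_notin_line tE) => /memvB/(_ (memv_line a')).
  by rewrite addrC addKr.
have d'0 : d' != 0 by apply: contraNneq d'Na => ->; rewrite mem0v.
have [d /(corr_sym isog) dd'] := corr_ex isog d'0 d'sq.
have a'bd : a' ∈ gen2 b' d'.
  have -> : a' = b' ∘ d' + d' ∘ b'.
    by rewrite /d' linearDr linearDl b'a' c'b' (Leib_mul0 b' a'L) add0r addrK.
  by rewrite memvD ?subalg_mul.
have bad : b ∈ gen2 a d by rewrite -(corr_mem_gen2 iso ab' dd' ba').
have dE : d ∈ gen2 b c by rewrite -(corr_mem_gen2 iso ba' cc' dd').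
have dNb : d \notin <[b]>%VS by rewrite -(corr_line iso dd' ba').
have dsq : d ∘ d = 0 by case: dd'.
have bNL := eigen_notin_Leib a0 ba.
have da : d ∘ a \in <[a]>%VS.
  have /memv_line_add[e [m [mL bE]]] := subvP (gen2_Leib_sub aL dsq) _ bad.
  have e0 : e != 0 by apply: contraNneq bNL => e0; rewrite bE e0 scale0r add0r.
  apply/vlineP; exists e^-1; rewrite -[in RHS]ba bE linearDl linearZl_LR.
  by rewrite (Leib_mul0 a mL) addr0 scalerK.
have /memv_line_add[p [_ [/vlineP[q ->] bE]]] :=
  subvP (gen2_eigen_sub aL dsq da) _ bad.
have [q0|q0] := eqVneq q 0.
  case/negP: dNb; apply: vlineP_sym => //; apply/vlineP; exists p.
  by rewrite bE q0 scale0r addr0.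
apply: (thick_eigen a0 aL ba tbc) => //.
have <- : q^-1 *: (b - p *: d) = a by rewrite bE addrC addKr scalerK.
by rewrite memvZ ?memvB ?memvZ.
Qed.

(** A nonzero [m'] in the intersection would commute with [a'] with zero product,
    and its preimage [m] would contradict [swapped_thick]. *)
Lemma swapped_Leib_cap0 c c' m' : corr f c c' -> thick (gen2 a c) ->
  m' ∈ gen2 b' c' -> m' ∈ Leib L' -> m' = 0.
Proof.
move=> cc' tac m'D m'L; apply/eqP/negPn/negP => m'0.
have tD := corr_thick iso ab' cc' tac.
have m'm' : m' ∘ m' = 0 by rewrite Leib_mul0.
have [m /(corr_sym isog) mm'] := corr_ex isog m'0 m'm'.
have m'Nb : m' \notin <[b']>%VS.
  apply: contra (eigen_notin_Leib a'0 b'a') => /(vlineP_sym m'0).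
  by apply: subvP; rewrite -memvE.
have m'Na : m' \notin <[a']>%VS.
  apply/negP => /(vlineP_sym m'0) a'm.
  apply: (thick_eigen a'0 a'L b'a' tD) => //.
  by apply: subvP a'm; rewrite -memvE.
apply: (swapped_thick mm').
  apply: (corr_thick isog (corr_sym iso ab') (corr_sym iso mm')).
  by rewrite (thick_gen2 tD).
apply: (corr_thick isog (corr_sym iso ba') (corr_sym iso mm')).
by apply: thick_gen2_comm => //; rewrite Leib_mul0.
Qed.

(** The subalgebra generated by [a'] and [d'] lies in [F d' + Leib L'], so if it
    contained [b'] then a nonzero kernel element would lie in the thick
    subalgebra generated by [b'] and [c']. *)
Lemma swapped_notin_gen2 c d : c != 0 -> c ∘ c = 0 -> thick (gen2 a c) ->
  d ∈ gen2 a c -> d \notin <[a]>%VS -> a ∉ gen2 b d.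
Proof.
move=> c0 cc tac dac dNa; apply/negP => abd.
have [c' cc'] := corr_ex iso c0 cc.
have d0 : d != 0 by apply: contraNneq dNa => ->; rewrite mem0v.
have [d' dd'] := corr_ex iso d0 (thick_sq0 tac dac).
have d'D : d' ∈ gen2 b' c' by rewrite (corr_mem_gen2 iso ab' cc' dd').
have : b' ∈ gen2 a' d' by rewrite (corr_mem_gen2 iso ba' dd' ab').
have d'sq : d' ∘ d' = 0 by case: dd'.
move=> /(subvP (gen2_Leib_sub a'L d'sq))/memv_line_add[e [m' [m'L b'E]]].
case/negP: dNa; rewrite -(corr_line iso dd' ab'); apply: vlineP_sym => //.
apply/vlineP; exists e; rewrite [LHS]b'E (_ : m' = 0) ?addr0 //.
apply: (swapped_Leib_cap0 cc' tac) => //.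
have <- : b' - e *: d' = m' by rewrite {1}b'E addrC addKr.
by rewrite memvB ?memvZ.
Qed.

(** If both [b'] and [c'] acted on [a'] by scalars, a combination [d'] of them
    would kill [a'], and its preimage would contradict [swapped_thick]. *)
Lemma swapped_no_eigen c c' : corr f c c' -> thick (gen2 a c) ->
  c' ∘ a' \notin <[a']>%VS.
Proof.
move=> cc' tac; apply/negP => /vlineP[k c'a'].
have tD := corr_thick iso ab' cc' tac.
pose d' := c' - k *: b'; have d'D : d' ∈ gen2 b' c' by rewrite memvB ?memvZ.
have d'a' : d' ∘ a' = 0 by rewrite !mulE c'a' b'a' subrr.
have d'Nb : d' \notin <[b']>%VS.
  apply: contra (thick_notin_line tD) => d'b.
  by rewrite -(subrK (k *: b') c') memvD ?memvZ ?memv_line.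
have d'0 : d' != 0 by apply: contraNneq d'Nb => ->; rewrite mem0v.
have d'sq := thick_sq0 tD d'D.
have [d /(corr_sym isog) dd'] := corr_ex isog d'0 d'sq.
have d'Na : d' \notin <[a']>%VS.
  apply/negP => /vlineP[t d'E]; case/eqP: d'0.
  apply: (swapped_Leib_cap0 cc' tac) => //; rewrite d'E memvZ //; exact: a'L.
apply: (swapped_thick dd').
  apply: (corr_thick isog (corr_sym iso ab') (corr_sym iso dd')).
  by rewrite (thick_gen2 tD).
apply: (corr_thick isog (corr_sym iso ba') (corr_sym iso dd')).
by apply: thick_gen2_comm => //; rewrite Leib_mul0.
Qed.

Lemma Leib_thick c : c ∈ Leib L -> c \notin <[a]>%VS -> thick (gen2 a c).
Proof. by move=> cL cNa; apply: thick_gen2_comm; rewrite ?Leib_mul0. Qed.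

(** Otherwise [b] and [c] span a two-dimensional subalgebra.  Its image has length
    at most two, which forces [c' ∘ a'] into the line of [a']. *)
Lemma swapped_eigenspace c : c ∈ Leib L -> b ∘ c = c -> c \in <[a]>%VS.
Proof.
move=> cL bc; apply/negPn/negP => cNa.
have tac := Leib_thick cL cNa.
have c0 : c != 0 by apply: contraNneq cNa => ->; rewrite mem0v.
have [c' cc'] := corr_ex iso c0 (Leib_mul0 c cL).
have c'NL : c' ∉ Leib L'.
  apply/negP => c'L; have [_ _ /eqP c'0 _ _] := cc'; apply: c'0.
  exact: (swapped_Leib_cap0 cc' tac).
case/negP: (swapped_no_eigen cc' tac).
have [->|x'0] := eqVneq (c' ∘ a') 0; first exact: mem0v.
have x'L : c' ∘ a' ∈ Leib L' by apply: Leib_ideal.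
have [x /(corr_sym isog) xx'] := corr_ex isog x'0 (Leib_mul0 _ x'L).
rewrite (corr_line iso xx' ba').
have : x ∈ gen2 b c.
  by rewrite -(corr_mem_gen2 iso ba' cc' xx') subalg_mul.
rewrite gen2C => xbc.
have bsq : b ∘ b = 0 by case: ba'.
have sub := gen2_eigen_sub cL bsq; rewrite bc in sub.
have /memv_line_add[s [_ [/vlineP[t ->] xE]]] := subvP (sub (memv_line c)) _ xbc.
have [t0|t0] := eqVneq t 0; first by rewrite xE t0 scale0r addr0 memvZ ?memv_line.
case/negP: c'NL.
have : c' ∈ gen2 a' (c' ∘ a').
  rewrite (corr_mem_gen2 iso ba' xx' cc').
  have <- : t^-1 *: (x - s *: b) = c by rewrite xE addrC addKr scalerK.
  by rewrite memvZ ?memvB ?memvZ.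
have le : subalg_le (gen2 a' (c' ∘ a')) (Leib L') by rewrite gen2_le a'L.
exact: (subvP le).
Qed.

(** Given [c] in the kernel and outside the line of [a], let [Z] be the kernel part
    of what [b, c] and [b, c + a] both generate.  By [swapped_notin_gen2] it does
    not contain [a], which spans the kernel of [b - 1] on [Leib L]; so [b - 1] is
    bijective on [Z].  Now [Z] contains
    [(b - 1) c = (b - 1) (c + a)], and therefore [c]; but then [b] and [c + a]
    generate [a]. *)
Lemma swapped_Leib_line : (Leib L <= <[a]>)%VS.
Proof.
apply/subvP => c cL; apply/negPn/negP => cNa.
have tac := Leib_thick cL cNa.
have c0 : c != 0 by apply: contraNneq cNa => ->; rewrite mem0v.
have cc : c ∘ c = 0 by rewrite Leib_mul0.
have caNa : c + a \notin <[a]>%VS.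
  by apply: contra cNa => /memvB/(_ (memv_line a)); rewrite addrK.
have ac : a ∉ gen2 b c by apply: (swapped_notin_gen2 c0 cc tac).
have aca : a ∉ gen2 b (c + a).
  by apply: (swapped_notin_gen2 c0 cc tac) => //; rewrite memvD.
pose T := (linfun (lbmul b) - \1)%VF.
have TE y : T y = b ∘ y - y by rewrite add_lfunE opp_lfunE id_lfunE lfunE.
pose Z := subalg_meet (subalg_meet (gen2 b c) (gen2 b (c + a))) (Leib L).
have ZP y : y ∈ Z = [&& y ∈ gen2 b c, y ∈ gen2 b (c + a) & y ∈ Leib L].
  by rewrite /= !memv_cap andbA.
have TZ y : y ∈ Z -> T y ∈ Z.
  rewrite !ZP TE => /and3P[? ? ?].
  by apply/and3P; split; apply: memvB => //; [apply: subalg_mul..|apply: Leib_ideal].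
have ker y : y ∈ gen2 b c -> y ∈ Leib L -> T y = 0 -> y = 0.
  rewrite TE => yc yL /eqP; rewrite subr_eq0 => /eqP by_.
  apply/eqP/negPn/negP => y0; case/negP: ac.
  have := vlineP_sym y0 (swapped_eigenspace yL by_).
  by apply: subvP; rewrite -memvE.
have TcZ : T c ∈ Z.
  have Tca : T (c + a) = T c by rewrite [LHS]linearD /= [T a]TE ba subrr addr0.
  rewrite ZP -{2}Tca !TE; apply/and3P; split; apply: memvB => //;
    do ?[by apply: subalg_mul | by apply: Leib_ideal | by apply: memvD].
have Zker z : z ∈ Z -> T z = 0 -> z = 0 by rewrite ZP => /and3P[? _ ?]; apply: ker.
have [z zZ Tcz] := stable_inj_surj TZ Zker TcZ.
move: zZ; rewrite ZP => /and3P[zc zca zL].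
have cz : c = z.
  apply/eqP; rewrite -subr_eq0; apply/eqP/ker; rewrite ?memvB //.
  by rewrite linearB /= Tcz subrr.
have cca : c ∈ gen2 b (c + a) by rewrite {1}cz.
have := memvB (mem_gen2r b (c + a)) cca.
have -> : c + a - c = a by rewrite addrC addKr.
by rewrite (negPf aca).
Qed.

End Swapped.

Lemma swapped_dim (F : fieldType) (L L' : leibnizType F)
    (f : subalg L -> subalg L') (g : subalg L' -> subalg L) a b a' b' :
  lat_iso f g -> swapped f a b a' b' -> (\dim {:L} <= 2)%N.
Proof.
move=> iso sw; have LA := swapped_Leib_line iso sw.
have LA' := swapped_Leib_line (lat_iso_sym iso) (swapped_sym iso sw).
have [aL ba a'L b'a' ab' ba'] := sw; have [a0 _ _ _ _] := ab'.
have [_ _ a'0 _ _] := ba'.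
suff sub : ({:L} <= <[a]> + <[b]>)%VS.
  apply: leq_trans (dimvS sub) _; apply: leq_trans (dimv_add_leqif _ _) _.
  by rewrite !dim_vline; case: (a != 0); case: (b != 0).
apply/subvP => c _; apply/negPn/negP => cN.
have /vlineP[l ca] := subvP LA _ (Leib_ideal c aL).
pose k := c - l *: b; have ka : k ∘ a = 0 by rewrite !mulE ca ba subrr.
have ak : a ∘ k = 0 by rewrite Leib_mul0.
have kN : k \notin <[a]>%VS.
  apply: contra cN => kA; rewrite -(subrK (l *: b) c) memv_add //.
  by rewrite memvZ ?memv_line.
clearbody k => {c cN ca}.
have k0 : k != 0 by apply: contraNneq kN => ->; rewrite mem0v.
(* In the other case, [a] spans the only atom of the subalgebra [F k + F a]. *)
have [kk|kk] := eqVneq (k ∘ k) 0.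
  have [k' kk'] := corr_ex iso k0 kk.
  have tak := thick_gen2_comm (Leib_mul0 a aL) kk ak ka a0 kN.
  have /negP[] := swapped_no_eigen iso sw kk' tak.
  by rewrite (subvP LA') ?Leib_ideal.
have [t kkE] : exists t, k ∘ k = t *: a.
  by apply/vlineP; rewrite (subvP LA) ?mem_Leib_sq.
have sU : is_subalg (<[k]> + <[a]>)%VS.
  apply: is_subalg_line_add => [||_ /vlineP[s ->]].
  - by rewrite -memvE.
  - by rewrite kkE memvZ ?memv_line.
  - by rewrite linearZr_LR ka scaler0 mem0v.
pose U := Subalg sU.
have aU : a ∈ U by rewrite (subvP (addvSr _ _)) ?memv_line.
have kU : k ∈ U by rewrite (subvP (addvSl _ _)) ?memv_line.
have Ua v : v ∈ U -> v ∘ a = 0.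
  by move=> /memv_line2[s [r ->]]; rewrite !mulE ka (Leib_mul0 a aL) !scaler0 addr0.
have Usq v : v ∈ U -> v ∘ v = 0 -> v \in <[a]>%VS.
  move=> vU; have /memv_line2[s [r vE]] := vU.
  rewrite {1}vE linearDl !linearZl_LR (Leib_mul0 v aL) scaler0 addr0.
  rewrite vE linearDr !linearZr_LR ka scaler0 addr0 => /eqP.
  rewrite !scaler_eq0 (negPf kk) orbF orbb => /eqP ->.
  by rewrite scale0r add0r memvZ ?memv_line.
have /subvPn[y' y'U y'N] : ~~ (f U <= <[b']>)%VS.
  have [_ b'b' ] : b' != 0 /\ b' ∘ b' = 0 by case: ab'.
  apply: contra kN => le; have [_ aa _ _ abE] := ab'.
  have : subalg_le (f U) (f (gen1 a)) by rewrite abE /subalg_le gen1_line.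
  by rewrite (iso_le iso) /subalg_le gen1_line // => /subvP; apply.
have y'0 : y' != 0 by apply: contraNneq y'N => ->; rewrite mem0v.
have [y'y'|y'y'] := eqVneq (y' ∘ y') 0.
  have [y /(corr_sym (lat_iso_sym iso)) yy'] := corr_ex (lat_iso_sym iso) y'0 y'y'.
  case/negP: y'N; rewrite (corr_line iso yy' ab') Usq //; last by case: yy'.
  by rewrite -(corr_mem iso _ yy').
have a'U : a' ∈ f U.
  have := vlineP_sym y'y' (subvP LA' _ (mem_Leib_sq y')).
  by apply: subvP; rewrite -memvE subalg_mul.
by case/eqP: a0; rewrite -ba Ua // -(corr_mem iso _ ba').
Qed.

(** * Cyclic subalgebras *)

(** The hypothesis says that [T] is surjective on [A / B], the conclusion that it
    is injective there. *)
Lemma stable_quotient_inj (F : fieldType) (V : vectType F) (T : 'End(V))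
    (A B : {vspace V}) : (B <= A)%VS -> (T @: B <= B)%VS -> (A <= B + T @: A)%VS ->
  forall r, r \in A -> T r \in B -> r \in B.
Proof.
move=> BA TB AT r rA TrB; pose P := (A :&: T @^-1: B)%VS.
have kerP : (P :&: lker T = A :&: lker T)%VS.
  apply/eqP; rewrite eqEsubv capvS ?capvSl //=; apply/subvP => y.
  rewrite !memv_cap memv_ker -memv_preim => /andP[-> /eqP ->].
  by rewrite mem0v eqxx.
have imP : (T @: P <= B :&: T @: A)%VS.
  rewrite subv_cap limgS ?capvSl // andbT; apply/subvP => _ /memv_imgP[y yP ->].
  by move: yP; rewrite memv_cap -memv_preim => /andP[].
have BP : (B <= P)%VS.
  rewrite subv_cap BA; apply/subvP => y yB.
  by rewrite -memv_preim (subvP TB) ?memv_img.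
have le : (\dim P <= \dim B)%N.
  have := limg_ker_dim T P; have := limg_ker_dim T A.
  have := dimv_sum_cap B (T @: A).
  have := dimvS imP; have := dimvS AT; rewrite kerP; lia.
have /eqP -> : B == P by rewrite eqEdim BP.
by rewrite memv_cap rA -memv_preim.
Qed.

Section Cyclic.
Variables (F : fieldType) (L : leibnizType F) (x : L).
Hypothesis xx : x ∘ x != 0.

Definition cyc_Leib : subalg L := subalg_meet (gen1 x) (Leib L).

Lemma cyc_Leib_Leib v : v ∈ cyc_Leib -> v ∈ Leib L.
Proof. by rewrite memv_cap => /andP[]. Qed.

Lemma cyc_Leib_gen1 v : v ∈ cyc_Leib -> v ∈ gen1 x.
Proof. by rewrite memv_cap => /andP[]. Qed.

Lemma cyc_Leib_sq : x ∘ x ∈ cyc_Leib.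
Proof.
by rewrite memv_cap; apply/andP; split; [apply: subalg_mul|apply: mem_Leib_sq].
Qed.

Lemma cyc_Leib_stable v : v ∈ cyc_Leib -> x ∘ v ∈ cyc_Leib.
Proof.
rewrite !memv_cap => /andP[vC vL]; apply/andP.
by split; [apply: subalg_mul|apply: Leib_ideal].
Qed.

Lemma gen1_sub_stable (X : {vspace L}) : (X <= Leib L)%VS -> x ∘ x \in X ->
  (forall v, v \in X -> x ∘ v \in X) -> (gen1 x <= <[x]> + X)%VS.
Proof.
move=> XL xxX xX; apply: gen1_sub; first exact: is_subalg_line_add.
by rewrite (subvP (addvSl _ _)) ?memv_line.
Qed.

(** [F x + X] is a subalgebra that contains [x], hence everything [x] generates,
    and [x] itself is outside the kernel. *)
Lemma cyc_Leib_sub (X : {vspace L}) : (X <= Leib L)%VS -> x ∘ x \in X ->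
  (forall v, v \in X -> x ∘ v \in X) -> (cyc_Leib <= X)%VS.
Proof.
move=> XL xxX xX; apply/subvP => v vA.
have /memv_line_add[s [w [wX vE]]] :=
  subvP (gen1_sub_stable XL xxX xX) _ (cyc_Leib_gen1 vA).
have [s0|s0] := eqVneq s 0; first by rewrite vE s0 scale0r add0r.
case/negP: (sq_notin_Leib xx).
have <- : s^-1 *: (v - w) = x by rewrite vE addrK scalerK.
by rewrite memvZ // memvB ?(cyc_Leib_Leib vA) ?(subvP XL).
Qed.

Lemma cyc_decomp y : y ∈ gen1 x -> exists s w, w ∈ cyc_Leib /\ y = s *: x + w.
Proof.
move=> yC; apply/memv_line_add; apply: subvP yC.
by apply: gen1_sub_stable; [apply: capvSr|apply: cyc_Leib_sq|apply: cyc_Leib_stable].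
Qed.

Lemma cyc_decomp1 y : y ∈ gen1 x -> y ∉ cyc_Leib ->
  exists s v, [/\ s != 0, v ∈ cyc_Leib & y = s *: (x + v)].
Proof.
move=> yC yN; have [s [w [wA yE]]] := cyc_decomp yC.
have s0 : s != 0 by apply: contraNneq yN => s0; rewrite yE s0 scale0r add0r.
by exists s, (s^-1 *: w); rewrite memvZ // scalerDr scalerA mulfV // scale1r.
Qed.

Lemma cyc_mul v r : v ∈ cyc_Leib -> (x + v) ∘ r = x ∘ r.
Proof. by move=> /cyc_Leib_Leib vL; rewrite linearDl /= (Leib_mul0 r vL) addr0. Qed.

Lemma cyc_sq v : v ∈ cyc_Leib -> (x + v) ∘ (x + v) = x ∘ x + x ∘ v.
Proof. by move=> vA; rewrite cyc_mul // linearDr. Qed.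

Lemma gen1_notin_cyc_Leib : x ∉ cyc_Leib.
Proof. by apply: contra (sq_notin_Leib xx) => /cyc_Leib_Leib. Qed.

End Cyclic.

Section CyclicIso.
Variables (F : fieldType) (L L' : leibnizType F).
Variables (f : subalg L -> subalg L') (g : subalg L' -> subalg L) (x : L).
Hypothesis iso : lat_iso f g.
Hypothesis xx : x ∘ x != 0.

Let fK : cancel f g. Proof. by case: iso. Qed.
Let gK : cancel g f. Proof. by case: iso. Qed.
Let isog : lat_iso g f := lat_iso_sym iso.

Let C := gen1 x.
Let A := cyc_Leib x.
Let A' := subalg_meet (f C) (Leib L').

Let AC : subalg_le A C. Proof. exact: capvSl. Qed.
Let BC' v : v ∈ f A -> v ∈ f C.
Proof. by apply: subvP; rewrite -/(subalg_le _ _) (iso_le iso). Qed.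

Lemma ex_outside_image : exists2 y', y' ∈ f C & y' ∉ f A.
Proof.
apply/subvPn; apply: contra (gen1_notin_cyc_Leib xx) => le.
by rewrite -gen1_le -(iso_le iso).
Qed.

Section KernelInside.
Hypothesis A'B : subalg_le A' (f A).

Let As := g A'.
Let AsA : subalg_le As A. Proof. by rewrite -(iso_le iso) gK. Qed.

(** The preimage of [F y' + A']; since [A' <= f A], this subalgebra meets [f A]
    only in [A']. *)
Lemma outside_slice y' : y' ∈ f C -> y' ∉ f A -> exists Y,
  [/\ subalg_le As Y, subalg_le Y C, y' ∈ f Y,
      subalg_le (subalg_meet Y A) As & subalg_le (subalg_meet (f Y) (f A)) A'].
Proof.
move=> y'C y'N.
have sY : is_subalg (<[y']> + A')%VS.
  apply: is_subalg_line_add; first exact: capvSr.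
    by rewrite memv_cap subalg_mul ?mem_Leib_sq.
  move=> w; rewrite !memv_cap => /andP[wC wL]; apply/andP.
  by split; [apply: subalg_mul|apply: Leib_ideal].
have cap : subalg_le (subalg_meet (Subalg sY) (f A)) A'.
  apply/subvP => v; rewrite memv_cap => /andP[/memv_line_add[s [w [wA' vE]]] vB].
  have [s0|s0] := eqVneq s 0; first by rewrite vE s0 scale0r add0r.
  case/negP: y'N; have <- : s^-1 *: (v - w) = y' by rewrite vE addrK scalerK.
  by rewrite memvZ // memvB // (subvP A'B).
exists (g (Subalg sY)); rewrite gK; split=> //.
- by rewrite (iso_le isog); apply: addvSr.
- rewrite -(iso_le iso) gK; apply/subvP => v /memv_line_add[s [w [wA' ->]]].
  by rewrite memvD ?memvZ //; move: wA'; rewrite memv_cap => /andP[].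
- by rewrite (subvP (addvSl _ _)) ?memv_line.
rewrite -(iso_le iso) [f As]gK; apply: subalg_le_trans cap.
rewrite subalg_meetP -{2}(gK (Subalg sY)) !(iso_le iso).
by rewrite [X in X && _]capvSl [X in _ && X]capvSr.
Qed.

Lemma slice_vector Y : subalg_le Y C -> ~~ subalg_le Y A ->
  exists2 v, v ∈ A & x + v ∈ Y.
Proof.
move=> YC /subvPn[y yY yN].
have [s [v [s0 vA yE]]] := cyc_decomp1 (subvP YC _ yY) yN.
exists v => //; have -> : x + v = s^-1 *: y by rewrite yE scalerK.
exact: memvZ.
Qed.

(** Modulo [As], the preimages of [F y' + A'] and [F (y' + w') + A'] contain
    [x + v] and [x + v2] of square zero, so [x] kills [v - v2]; it acts
    injectively on [A / As], and the two preimages coincide. *)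
Lemma cyc_image_sub : subalg_le (f A) A'.
Proof.
have [y' y'C y'N] := ex_outside_image.
apply/subvP => w' w'B; have w'C := BC' w'B.
have y2C : y' + w' ∈ f C by apply: memvD.
have y2N : y' + w' ∉ f A.
  by apply: contra y'N => /memvB/(_ w'B); rewrite addrK.
have [Y [AsY YC y'Y capY capY']] := outside_slice y'C y'N.
have [Y2 [AsY2 Y2C y2Y capY2 _]] := outside_slice y2C y2N.
have notA V v' : v' ∈ f V -> v' ∉ f A -> ~~ subalg_le V A.
  move=> vV; apply: contra => VA; apply: (subvP _ _ vV).
  by rewrite -/(subalg_le _ _) (iso_le iso).
have [v vA zY] := slice_vector YC (notA _ _ y'Y y'N).
have [v2 v2A z2Y] := slice_vector Y2C (notA _ _ y2Y y2N).
have inAs V r : subalg_le (subalg_meet V A) As -> r ∈ V -> r ∈ A -> r ∈ As.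
  by move=> cap rV rA; apply: (subvP cap); rewrite memv_cap rV.
have stabAs r : r ∈ As -> x ∘ r ∈ As.
  move=> rAs; rewrite -(cyc_mul r vA); apply: (inAs Y) => //.
    by apply: subalg_mul => //; apply: (subvP AsY).
  by rewrite cyc_mul //; apply: cyc_Leib_stable; apply: (subvP AsA).
have sqAs V u : subalg_le (subalg_meet V A) As -> u ∈ A -> x + u ∈ V ->
    x ∘ x + x ∘ u ∈ As.
  move=> cap uA uV; apply: (inAs V) => //; first by rewrite -cyc_sq // subalg_mul.
  by rewrite memvD ?cyc_Leib_sq ?cyc_Leib_stable.
have vvAs : v - v2 ∈ As.
  pose T := linfun (lbmul x).
  have TE r : T r = x ∘ r by rewrite lfunE.
  have TA r : r ∈ A -> T r \in (T @: A)%VS by move=> rA; apply: memv_img.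
  apply: (@stable_quotient_inj _ _ T A As) => //.
  - by apply/subvP => _ /memv_imgP[r rAs ->]; rewrite TE stabAs.
  - apply: cyc_Leib_sub => //.
    + rewrite subv_add (subv_trans AsA) ?capvSr //=.
      apply/subvP => _ /memv_imgP[r rA ->]; rewrite TE.
      exact: Leib_ideal (cyc_Leib_Leib rA).
    + rewrite -(addrK (x ∘ v) (x ∘ x)) memvB //.
        by rewrite (subvP (addvSl _ _)) // (sqAs Y).
      by rewrite (subvP (addvSr _ _)) // -TE TA.
    + move=> _ /memv_addP[r rAs [_ /memv_imgP[q qA ->] ->]].
      rewrite linearDr /= memv_add ?stabAs // -TE TA // TE.
      exact: cyc_Leib_stable.
  - by rewrite memvB.
  have -> : T (v - v2) = (x ∘ x + x ∘ v) - (x ∘ x + x ∘ v2).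
    by rewrite TE linearBr /= opprD addrACA subrr add0r.
  by apply: memvB; [apply: sqAs capY vA zY|apply: sqAs capY2 v2A z2Y].
have z2Y' : x + v2 ∈ Y.
  have -> : x + v2 = (x + v) - (v - v2) by rewrite opprB addrACA subrr addr0.
  by apply: memvB => //; apply: (subvP AsY).
have Y2Y : subalg_le Y2 Y.
  apply/subvP => y yY2; have [s [w [wA yE]]] := cyc_decomp (subvP Y2C _ yY2).
  have wE : w - s *: v2 = y - s *: (x + v2).
    by rewrite yE scalerDr opprD addrACA subrr add0r.
  rewrite -(subrK (s *: (x + v2)) y) memvD ?memvZ // (subvP AsY) // -wE.
  apply: (inAs Y2) => //; first by rewrite wE memvB ?memvZ.
  by rewrite memvB ?memvZ.
apply: (subvP capY'); rewrite memv_cap w'B andbT.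
rewrite -(addKr y' w') addrC memvB //.
by apply: (subvP _ _ y2Y); rewrite -/(subalg_le _ _) (iso_le iso).
Qed.

End KernelInside.

Section KernelOutside.
Variable m' : L'.
Hypothesis m'A' : m' ∈ A'.
Hypothesis m'N : m' ∉ f A.

(** An atom outside [f A] comes from some [x + v] of square zero.  Multiplication
    by [x] is then bijective on [A], so [v] is unique and the line of [m'] is the
    only atom of [f C] outside [f A].  Hence [A'] is this line.  Two-dimensionality
    of [F m' + F w'] for [w'] in [f A] makes every vector of [A] an
    eigenvector, so that [A] is the line of [x ∘ x]. *)
Lemma kernel_outside_swapped : exists a b a' b', swapped f a b a' b'.
Proof.
have [m'C m'L] : m' ∈ f C /\ m' ∈ Leib L'.
  by move: m'A'; rewrite memv_cap => /andP.
have m'0 : m' != 0 by apply: contraNneq m'N => ->; rewrite mem0v.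
have m'm' : m' ∘ m' = 0 by rewrite Leib_mul0.
have outside n' : n' ∈ f C -> n' ∉ f A -> n' ∘ n' = 0 ->
    exists2 v, v ∈ A & corr f (x + v) n' /\ x ∘ x + x ∘ v = 0.
  move=> n'C n'N n'n'.
  have n'0 : n' != 0 by apply: contraNneq n'N => ->; rewrite mem0v.
  have [n /(corr_sym isog) nn'] := corr_ex isog n'0 n'n'.
  have nC : n ∈ C by rewrite -(corr_mem iso _ nn').
  have nN : n ∉ A by rewrite -(corr_mem iso _ nn').
  have [s [v [s0 vA nE]]] := cyc_decomp1 nC nN; exists v => //.
  have cv : corr f (x + v) n'.
    by rewrite -(scalerK s0 (x + v)) -nE; apply: corrZ; rewrite ?invr_eq0.
  by split=> //; rewrite -cyc_sq //; case: cv.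
have [v vA [bm' sqv]] := outside m' m'C m'N m'm'.
pose T := linfun (lbmul x); have TE r : T r = x ∘ r by rewrite lfunE.
have ATA : (A <= T @: A)%VS.
  apply: cyc_Leib_sub => //.
  - apply/subvP => _ /memv_imgP[r rA ->]; rewrite TE.
    exact: Leib_ideal (cyc_Leib_Leib rA).
  - apply/memv_imgP; exists (- v); rewrite ?memvN // TE linearNr.
    by apply/eqP; rewrite -addr_eq0 sqv.
  move=> _ /memv_imgP[r rA ->]; rewrite TE -TE.
  exact/memv_img/cyc_Leib_stable.
have Tinj r : r ∈ A -> x ∘ r = 0 -> r = 0.
  move=> rA xr; apply/eqP; rewrite -memv0.
  apply: (@stable_quotient_inj _ _ T A 0%VS); rewrite ?sub0v ?limg0 ?add0v //.
  by rewrite TE xr mem0v.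
have uniq n' : n' ∈ f C -> n' ∉ f A -> n' ∘ n' = 0 -> n' \in <[m']>%VS.
  move=> n'C n'N n'n'; have [v2 v2A [bn' sqv2]] := outside n' n'C n'N n'n'.
  rewrite (corr_line iso bn' bm').
  suff -> : v2 = v by exact: memv_line.
  apply/eqP; rewrite -subr_eq0; apply/eqP/Tinj; first exact: memvB.
  by move: sqv2; rewrite -sqv linearBr /= => /addrI ->; rewrite subrr.
have A'm n' : n' ∈ A' -> n' \in <[m']>%VS.
  rewrite memv_cap => /andP[n'C n'L].
  have [n'B|n'B] := boolP (n' ∈ f A); last by apply: uniq; rewrite ?Leib_mul0.
  have : m' + n' \in <[m']>%VS.
    apply: uniq; first exact: memvD.
      by apply: contra m'N => /memvB/(_ n'B); rewrite addrK.
    by apply: Leib_mul0; apply: memvD.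
  by move=> /memvB/(_ (memv_line m')); rewrite addrC addKr.
have AB' w w' : w ∈ A -> corr f w w' -> w' ∘ m' \in <[m']>%VS.
  move=> wA ww'; apply: A'm; rewrite memv_cap; apply/andP.
  split; last exact: Leib_ideal.
  by apply: subalg_mul => //; apply: BC'; rewrite (corr_mem iso _ ww').
have eigen w : w ∈ A -> x ∘ w \in <[w]>%VS.
  move=> wA; have [->|w0] := eqVneq w 0; first by rewrite linear0r mem0v.
  have [->|u0] := eqVneq (x ∘ w) 0; first by rewrite mem0v.
  have uA : x ∘ w ∈ A by apply: cyc_Leib_stable.
  have sq0 r : r ∈ A -> r ∘ r = 0 by move=> /cyc_Leib_Leib rL; rewrite Leib_mul0.
  have [w' ww'] := corr_ex iso w0 (sq0 _ wA).
  have [u' uu'] := corr_ex iso u0 (sq0 _ uA).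
  have u'g : u' ∈ gen2 m' w'.
    by rewrite (corr_mem_gen2 iso bm' ww' uu') -(cyc_mul w vA) subalg_mul.
  have w'w' : w' ∘ w' = 0 by case: ww'.
  have /memv_line_add[s [_ [/vlineP[t ->] uE]]] :=
    subvP (gen2_eigen_sub m'L w'w' (AB' _ _ wA ww')) _ u'g.
  rewrite -(corr_line iso uu' ww').
  have [t0|t0] := eqVneq t 0; first by rewrite uE t0 scale0r addr0 memvZ ?memv_line.
  case/negP: m'N.
  have <- : t^-1 *: (u' - s *: w') = m' by rewrite uE addrC addKr scalerK.
  by rewrite memvZ // memvB ?memvZ // ?(corr_mem iso _ ww') ?(corr_mem iso _ uu').
(* It remains to scale [x + v] and [w'] so that both eigenvalues become one. *)
pose a := x ∘ x; have aA : a ∈ A by apply: cyc_Leib_sq.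
have aL := cyc_Leib_Leib aA.
have /vlineP[l xa] := eigen a aA.
have l0 : l != 0.
  by apply: contraNneq xx => l0; apply/eqP/(Tinj a) => //; rewrite xa l0 scale0r.
have [w' aw'] := corr_ex iso xx (Leib_mul0 a aL).
have /vlineP[k w'm'] := AB' _ _ aA aw'.
have w'B : w' ∈ f A by rewrite (corr_mem iso _ aw').
have k0 : k != 0.
  apply/negP => /eqP k0; rewrite k0 scale0r in w'm'.
  have w'w' : w' ∘ w' = 0 by case: aw'.
  have : m' + w' \in <[m']>%VS.
    apply: uniq; first by apply: memvD => //; apply: BC'.
      by apply: contra m'N => /memvB/(_ w'B); rewrite addrK.
    by rewrite lbmul_sqD m'm' w'w' w'm' (Leib_mul0 w' m'L) !addr0.
  move=> /memvB/(_ (memv_line m')); rewrite addrC addKr.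
  have w'0 : w' != 0 by case: aw'.
  move=> /(vlineP_sym w'0) m'w; case/negP: m'N.
  by apply: subvP m'w; rewrite -memvE.
exists a, (l^-1 *: (x + v)), m', (k^-1 *: w'); split=> //.
- by rewrite linearZl_LR cyc_mul // xa scalerK.
- by rewrite linearZl_LR w'm' scalerK.
- by apply: (corr_sym isog); apply: corrZ; rewrite ?invr_eq0 //; apply: corr_sym aw'.
- by apply: corrZ; rewrite ?invr_eq0.
Qed.

End KernelOutside.

Lemma cyclic_dichotomy : subalg_le (f (gen1 (x ∘ x))) (Leib L') \/
  exists a b a' b', swapped f a b a' b'.
Proof.
have [le|/subvPn[m' m'A m'N]] := boolP (subalg_le A' (f A)); last first.
  by right; apply: kernel_outside_swapped m'A m'N.
left; apply: (@subalg_le_trans _ _ (f A)).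
  by rewrite (iso_le iso) gen1_le; apply: cyc_Leib_sq.
by apply: subalg_le_trans (cyc_image_sub le) _; apply: capvSr.
Qed.

End CyclicIso.

Lemma iso_Leib_sub (F : fieldType) (L L' : leibnizType F)
    (f : subalg L -> subalg L') (g : subalg L' -> subalg L) :
  lat_iso f g -> ~ (exists a b a' b', swapped f a b a' b') ->
  subalg_le (f (Leib L)) (Leib L').
Proof.
move=> iso nsw; have [fK gK _] := iso; rewrite -(gK (Leib L')) (iso_le iso).
apply/lspan_sub => _ [x ->].
have [->|xx] := eqVneq (x ∘ x) 0; first exact: mem0v.
rewrite -gen1_le -(iso_le iso) gK.
by have [|/nsw] := cyclic_dichotomy iso xx.
Qed.

Theorem theorem3p1 (F : fieldType) (L L' : leibnizType F)
    (phi : {lmorphism (subalg L) -> (subalg L')}) (phi_bij : bijective phi)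
    (dimL : (3 <= \dim {:L})%N) :
  phi (Leib L) = Leib L'.
Proof.
have [g phiK gK] := phi_bij.
have iso : lat_iso phi g.
  split=> // U V; apply/idP/idP => [le|le]; last exact: (omorph_le phi le).
  apply/(@meet_idPl _ _ U V)/(can_inj phiK); rewrite omorphI; exact/meet_idPl.
have nsw : ~ exists a b a' b', swapped phi a b a' b'.
  by case=> a [b [a' [b' /(swapped_dim iso)]]]; rewrite leqNgt dimL.
apply: subalg_le_anti; rewrite (iso_Leib_sub iso nsw) /=.
have iso' := lat_iso_sym iso.
rewrite -(iso_le iso') phiK; apply: (iso_Leib_sub iso') => -[a' [b' [a [b sw]]]].
by apply: nsw; exists a, b, a', b'; apply: (swapped_sym iso').
Qed.
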